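(* There are absolute constants $0<c\le C<\infty$ such that, for all integers $s\ge3$ and $L\ge1$, \[ c\,s^{-2}\le\lambda_1(L,sL-1)-1\le C\,s^{-2}. \] That is, $\lambda_1(L,sL-1)-1\asymp s^{-2}$ uniformly in $s$ and $L$.
   Context: Let $\mathbb T=\mathbb R/(2\pi\mathbb Z)$ and let $C(\mathbb T)$ be the real Banach space of real-valued continuous $2\pi$-periodic functions with the uniform norm; it is identified with $C(\mathbb S^1)$ via $\theta\mapsto(\cos\theta,\sin\theta)$. For $n\ge0$, $\mathbb P_n(\mathbb T)=\{a_0+\sum_{k=1}^n(a_k\cos(k\theta)+b_k\sin(k\theta)):a_k,b_k\in\mathbb R\}$ is the space of real trigonometric polynomials of degree at most $n$, identified with the space $\mathbb P_n(\mathbb S^1)$ of spherical polynomials of degree at most $n$. For integers $0\le L\le N$, $\lambda_1(L,N)$ is the infimum of the operator norms $\|\mathcal A\|_{C(\mathbb T)\to C(\mathbb T)}$ over all bounded linear operators $\mathcal A:C(\mathbb T)\to C(\mathbb T)$ such that $\mathcal Ap=p$ for all $p\in\mathbb P_L(\mathbb T)$ and the range of $\mathcal A$ is contained in $\mathbb P_N(\mathbb T)$. *)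

(* Defs.v *)
From HB Require Import structures.
From mathcomp Require Import all_boot all_order all_algebra.
From mathcomp Require Import all_classical all_reals all_analysis.

Set Implicit Arguments.
Unset Strict Implicit.
Unset Printing Implicit Defensive.

Import Order.TTheory GRing.Theory Num.Theory.
Import numFieldTopology.Exports numFieldNormedType.Exports.

Local Open Scope classical_set_scope.
Local Open Scope ring_scope.

Section CircleFunctions.
Variable R : realType.

Definition circle_cts : {pred R -> R} :=
  fun f => `[< continuous f /\ periodic f (pi *+ 2) >].

Lemma circle_ctsP (f : R -> R) :
  reflect (continuous f /\ periodic f (pi *+ 2)) (f \in circle_cts).
Proof. exact: asboolP. Qed.

Lemma circle_cts_submod : GRing.submod_closed circle_cts.
Proof.
split=> [|a f g /circle_ctsP [cf pf] /circle_ctsP [cg pg]]; apply/circle_ctsP.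
  by split=> [x|x] //; exact: cvg_cst.
split=> [x|x].
  apply: cvgD; last exact: cg.
  by apply: cvgZr; exact: cf.
by rewrite !fctE pf pg.
Qed.

HB.instance Definition _ :=
  GRing.isSubmodClosed.Build R (R -> R) circle_cts circle_cts_submod.

(* C(T), with T = R/(2 pi Z); the instances below make it a normed module over R
   whose norm is [sup_norm]. *)
Record circle_fun := CircleFun {
  circle_val :> R -> R;
  circle_valP : circle_val \in circle_cts }.

HB.instance Definition _ := [isSub for circle_val].
HB.instance Definition _ := [Choice of circle_fun by <:].
HB.instance Definition _ := [SubChoice_isSubLmodule of circle_fun by <:].

Implicit Types f g : circle_fun.

Definition sup_norm f : R := sup [set `|f t| | t in [set: R]].

Lemma circle_fun_periodicz f (m : int) t : f (t + (pi *+ 2) *~ m) = f t.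
Proof.
have [_ pf] := circle_ctsP _ (circle_valP f).
case: m => n; first by rewrite -pmulrn (periodicn pf).
rewrite NegzE mulrNz -pmulrn.
by rewrite -[in RHS](subrK ((pi *+ 2) *+ n.+1) t) (periodicn pf).
Qed.

Lemma sup_norm_has_sup f : has_sup [set `|f t| | t in [set: R]].
Proof.
split; first by exists `|f 0|, 0.
have [cf _] := circle_ctsP _ (circle_valP f).
have T0 : 0 < pi *+ 2 :> R by rewrite mulrn_wgt0 ?pi_gt0.
have [M [_ hM]] : bounded_set (f @` `[0, pi *+ 2]).
  apply/compact_bounded/continuous_compact; last exact: segment_compact.
  exact: continuous_subspaceT.
exists (M + 1) => _ [t _ <-].
apply: (hM (M + 1)); first by rewrite ltrDl.
pose m := Num.floor (t / (pi *+ 2)).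
exists (t + (pi *+ 2) *~ (- m)); last exact: circle_fun_periodicz.
have /andP[m1 m2] := floor_itv (t / (pi *+ 2)).
rewrite /= in_itv /= mulrNz -mulrzl subr_ge0 lerBlDl -/m.
move: m1 m2; rewrite -/m ler_pdivlMr// ltr_pdivrMr// intrD mulrDl mul1r.
by move=> -> /ltW.
Qed.

Lemma ler_sup_norm f t : `|f t| <= sup_norm f.
Proof. by apply: sup_upper_bound; [exact: sup_norm_has_sup|exists t]. Qed.

Lemma sup_norm_le f (M : R) : (forall t, `|f t| <= M) -> sup_norm f <= M.
Proof.
by move=> fM; apply: ge_sup; [exists `|f 0|, 0|move=> _ [t _ <-]].
Qed.

Lemma ler_sup_normD f g : sup_norm (f + g) <= sup_norm f + sup_norm g.
Proof.
apply: sup_norm_le => t.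
by rewrite (le_trans (ler_normD _ _))// lerD// ler_sup_norm.
Qed.

Lemma sup_normZ (a : R) f : sup_norm (a *: f) = `|a| * sup_norm f.
Proof.
have le b g : sup_norm (b *: g) <= `|b| * sup_norm g.
  apply: sup_norm_le => t.
  by rewrite [X in `|X|](_ : _ = b * g t)// normrM ler_wpM2l// ler_sup_norm.
apply/eqP; rewrite eq_le le/=.
have [->|a0] := eqVneq a 0.
  by rewrite normr0 mul0r (le_trans _ (ler_sup_norm _ 0)).
rewrite -ler_pdivlMl ?normr_gt0// -normfV.
by rewrite -[leLHS](_ : sup_norm (a^-1 *: (a *: f)) = _) ?le// scalerA mulVf// scale1r.
Qed.

Lemma sup_norm0_eq0 f : sup_norm f = 0 -> f = 0.
Proof.
move=> f0; apply/val_inj/funext => t /=.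
by apply/eqP; rewrite -normr_le0 -f0 ler_sup_norm.
Qed.

HB.instance Definition _ := Lmodule_isNormed.Build R circle_fun
  ler_sup_normD sup_normZ sup_norm0_eq0.

Definition trig_poly (n : nat) : set circle_fun :=
  [set f | exists a b : nat -> R, forall t, f t =
    a 0%N + \sum_(1 <= k < n.+1) (a k * cos (k%:R * t) + b k * sin (k%:R * t))].

Definition op_norm (A : circle_fun -> circle_fun) : R :=
  sup [set `|A f| | f in [set f | `|f| <= 1]].

Lemma op_norm_has_sup (A : {linear circle_fun -> circle_fun}) :
  bounded_near A (nbhs (0 : circle_fun)) ->
  has_sup [set `|A f| | f in [set f : circle_fun | `|f| <= 1]].
Proof.
move=> /bounded_funP /(_ 1)[M AM]; split.
  by exists `|A 0|, 0 => //=; rewrite normr0.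
by exists M => _ [f /= f1 <-]; exact: AM.
Qed.

(* By [linear_boundedP], [bounded_near A (nbhs 0)] says that the linear map [A]
   is a bounded operator. *)
Definition reproducing_op (L N : nat) : set {linear circle_fun -> circle_fun} :=
  [set A | [/\ bounded_near A (nbhs (0 : circle_fun)),
               forall p, trig_poly L p -> A p = p
             & range A `<=` trig_poly N]].

(* [inf set0] is 0, but [reproducing_op L N] is nonempty whenever [L <= N]: it
   contains trigonometric interpolation of degree [L]. *)
Definition lambda1 (L N : nat) : R :=
  inf [set op_norm A | A in reproducing_op L N].

End CircleFunctions.

(* Main.v *)
(* Lower bound.  Put n = s L and f(t) = cos(L t) + (1 - cos(n t)) / s^2.  Since
   1 - cos(s u) <= s^2 (1 - cos u), |f| <= 1.  An operator A reproducing P_L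
   fixes 1 and cos(L t), so if it killed cos(n t), then A f (0) would be
   1 + 1/s^2.  Averaging T_(-y) A T_y over the translations by y = pi j / n,
   j < 2n, removes the term cos(n t), because the range of A consists of
   polynomials of degree < n.

   Upper bound.  The nonnegative kernel |sum_(j < r) a_j e^(i j t)|^2 sampled at
   M equidistant nodes gives an operator multiplying cos(k t + phi) by the
   autocorrelation sum_j a_j a_(j+k), of norm at most sum_j a_j^2.  For
   a_j = sin(pi j / n), r = n (the Fejer-Korovkin kernel), the normalised
   multiplier rho has second differences O(n^-2).  The defect 1 - rho is, on
   [0, L], a combination of the tents (r - k)_+ (Fejer kernels, r <= 2L) of
   total norm O(L^2 / n^2) = O(s^-2); adding it makes the multiplier 1 there. *)
Require Import Defs.
From HB Require Import structures.
From mathcomp Require Import all_boot all_order all_algebra.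
From mathcomp Require Import all_classical all_reals all_analysis.
From mathcomp Require Import ring lra zify.

Set Implicit Arguments.
Unset Strict Implicit.
Unset Printing Implicit Defensive.

Import Order.TTheory GRing.Theory Num.Theory.
Import numFieldTopology.Exports numFieldNormedType.Exports.
Local Open Scope ring_scope.

(** * Trigonometric sums *)

Section Trigonometry.
Variable R : realType.
Implicit Types x y phi : R.

Lemma cos_mul_cos x y : cos x * cos y = (cos (x + y) + cos (x - y)) / 2.
Proof. by rewrite cosD cosB; field. Qed.

Lemma sin_le_id x : 0 <= x -> sin x <= x.
Proof.
rewrite le_eqVlt => /predU1P[<-|x0]; first by rewrite sin0.
have [|c _] := @MVT R sin cos 0 x x0 (fun y _ => is_derive_sin y).
  by apply: continuous_subspaceT => y; exact: continuous_sin.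
rewrite sin0 !subr0 => ->; rewrite -[leRHS]mul1r.
by rewrite ler_wpM2r ?cos_le1// ltW.
Qed.

Lemma one_sub_cos x : 1 - cos x = 2 * sin (x / 2) ^+ 2.
Proof.
rewrite [in LHS](_ : x = (x / 2) *+ 2); last by rewrite -mulr_natr; field.
by rewrite cos_mulr2n cos2sin2; ring.
Qed.

Lemma one_sub_cos_le x : 0 <= x -> x <= pi -> 1 - cos x <= x ^+ 2 / 2.
Proof.
move=> x0 xpi; rewrite one_sub_cos.
have s0 : 0 <= sin (x / 2) by apply: sin_ge0_pi; apply/andP; split; lra.
have sx : sin (x / 2) <= x / 2 by apply: sin_le_id; lra.
have := ler_pXn2r (ltn0Sn 1) s0 (le_trans s0 sx); rewrite sx => /idP; lra.
Qed.

Lemma normr_sin_mulnl (n : nat) x : `|sin (n%:R * x)| <= n%:R * `|sin x|.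
Proof.
elim: n => [|n IH]; first by rewrite !mul0r sin0 normr0.
rewrite -natr1 mulrDl mul1r sinD (le_trans (ler_normD _ _))// !normrM mulrDl.
rewrite mul1r lerD//.
  by rewrite (le_trans _ IH)// ler_piMr// cos_max.
by rewrite ler_piMl// cos_max.
Qed.

(** In half angles this is the square of [normr_sin_mulnl]. It is what keeps the test function of
    the lower bound within norm 1. *)
Lemma one_sub_cos_mulnl (n : nat) x :
  1 - cos (n%:R * x) <= n%:R ^+ 2 * (1 - cos x).
Proof.
rewrite !one_sub_cos [leRHS]mulrCA ler_pM2l// -[_ * x / 2]mulrA.
rewrite -[leLHS]real_normK ?num_real// -[X in _ <= _ * X]real_normK ?num_real//.
by rewrite -exprMn ler_pXn2r ?nnegrE ?mulr_ge0// normr_sin_mulnl.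
Qed.

Definition node (M l : nat) : R := pi *+ 2 * l%:R / M%:R.

(** Multiplying by [sin h] with [h = pi * m / M], which is positive for these [m], makes the sum
    telescope; the two end terms differ by [m] full periods. *)
Lemma sum_cos_node_gt0 (M m : nat) phi : (0 < m < M)%N ->
  \sum_(0 <= l < M) cos (m%:R * node M l + phi) = 0.
Proof.
case/andP=> m0 mM.
have nodeE (p a b c : R) : a * (p *+ 2 * b / c) = (p * a / c) *+ 2 * b.
  by rewrite !mulr2n; ring.
have M0 : 0 < M%:R :> R by rewrite ltr0n; lia.
set h : R := pi * m%:R / M%:R.
have h0 : 0 < sin h.
  apply: sin_gt0_pi; apply/andP; split; rewrite /h.
    by rewrite divr_gt0// mulr_gt0 ?pi_gt0// ltr0n.
  by rewrite ltr_pdivrMr// ltr_pM2l ?pi_gt0// ltr_nat.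
apply: (@mulfI _ (sin h)); first exact: lt0r_neq0.
rewrite mulr0 mulr_sumr.
under eq_bigr => l _.
  rewrite (_ : sin h * _ = sin (h *+ 2 * l.+1%:R - h + phi) / 2
                       - sin (h *+ 2 * l%:R - h + phi) / 2); last first.
    rewrite /node nodeE -/h.
    rewrite -natr1 mulrDr mulr1; set z := h *+ 2 * l%:R.
    rewrite (_ : z + _ - h + phi = (z + phi) + h); last by rewrite mulr2n; ring.
    rewrite (_ : z - h + phi = (z + phi) - h); last by ring.
    by rewrite sinD sinB; field.
  over.
rewrite telescope_sumr// mulr0.
have -> : h *+ 2 * M%:R = (pi *+ 2) *+ m.
  by rewrite /h -nodeE mulfK ?lt0r_neq0// mulr_natl.
by rewrite -addrA addrC (periodicn (@sinD2pi R)) add0r subrr.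
Qed.

(** Discrete orthogonality. The hypotheses say [|p - q| < M], which excludes aliasing; the
    difference is taken in [R] so that both signs are covered. *)
Lemma sum_cos_node (M p q : nat) phi : (p < M + q)%N -> (q < M + p)%N ->
  \sum_(0 <= l < M) cos ((p%:R - q%:R) * node M l + phi)
  = (p == q)%:R * M%:R * cos phi.
Proof.
move=> pM qM; have [pq|qp|<-] := ltngtP p q.
- rewrite !mul0r -[RHS](@sum_cos_node_gt0 M (q - p) (- phi)); last lia.
  by apply: eq_bigr => l _; rewrite natrB 1?ltnW// -[LHS]cosN; congr cos; ring.
- rewrite !mul0r -[RHS](@sum_cos_node_gt0 M (p - q) phi); last lia.
  by apply: eq_bigr => l _; rewrite natrB 1?ltnW.
- rewrite mul1r; under eq_bigr do rewrite subrr mul0r add0r.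
  by rewrite sumr_const_nat subn0 mulr_natl.
Qed.

End Trigonometry.

(** * Trigonometric polynomials in C(T) *)

Section Waves.
Variable R : realType.
Local Notation CT := (circle_fun R).
Implicit Types (f g : CT) (phi x : R).

Lemma wave_subproof (m : nat) phi :
  (fun x => cos (m%:R * x + phi)) \in @circle_cts R.
Proof.
apply/circle_ctsP; split=> x.
  apply: (@continuous_comp _ _ _ (fun x => m%:R * x + phi) cos);
    last exact: continuous_cos.
  by apply: cvgD; [apply: cvgM; [exact: cvg_cst|exact: cvg_id]|exact: cvg_cst].
rewrite (_ : _ + phi = m%:R * x + phi + (pi *+ 2) *+ m).
  by rewrite (periodicn (@cosD2pi R)).
by rewrite mulrDr [m%:R * (pi *+ 2)]mulr_natl addrAC.
Qed.

(** The phase treats cosines and sines ([phi = - pi / 2]) at once and makes the family stable under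
    translation. *)
Definition wave (m : nat) phi : CT := CircleFun (wave_subproof m phi).

Lemma waveE m phi x : wave m phi x = cos (m%:R * x + phi).
Proof. by []. Qed.

Lemma circle_funD f g x : (f + g) x = f x + g x.
Proof. by []. Qed.

Lemma circle_funZ (a : R) f x : (a *: f) x = a * f x.
Proof. by []. Qed.

Lemma circle_fun_sum I (r : seq I) (P : pred I) (F : I -> CT) x :
  (\sum_(i <- r | P i) F i) x = \sum_(i <- r | P i) F i x.
Proof. by elim/big_rec2: _ => // i y f _ <-. Qed.

Lemma circle_fun_eq f g : f =1 g -> f = g.
Proof. by move=> fg; apply/val_inj/funext. Qed.

Lemma circle_norm_le f (M : R) : (forall x, `|f x| <= M) -> `|f| <= M.
Proof. exact: sup_norm_le. Qed.

Lemma ler_circle_norm f x : `|f x| <= `|f|.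
Proof. exact: ler_sup_norm. Qed.

Lemma trig_polyD n f g : trig_poly n f -> trig_poly n g -> trig_poly n (f + g).
Proof.
move=> [a [b fE]] [c [d gE]]; exists (a \+ c), (b \+ d) => x.
rewrite circle_funD fE gE addrACA -big_split/=; congr (_ + _).
by apply: eq_bigr => k _; ring.
Qed.

Lemma trig_polyZ n (c : R) f : trig_poly n f -> trig_poly n (c *: f).
Proof.
move=> [a [b fE]]; exists (fun k => c * a k), (fun k => c * b k) => x.
rewrite circle_funZ fE mulrDr mulr_sumr; congr (_ + _).
by apply: eq_bigr => k _; ring.
Qed.

Lemma trig_poly_sum n I (r : seq I) (P : pred I) (F : I -> CT) :
  (forall i, P i -> trig_poly n (F i)) -> trig_poly n (\sum_(i <- r | P i) F i).
Proof.
move=> nF; elim/big_ind : _ => //; last exact: trig_polyD.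
exists (fun=> 0), (fun=> 0) => x.
by rewrite big1 ?addr0// => k _; rewrite !mul0r addr0.
Qed.

Lemma trig_poly_wave n m phi : (m <= n)%N -> trig_poly n (wave m phi).
Proof.
move=> mn.
exists (fun k => (k == m)%:R * cos phi), (fun k => - ((k == m)%:R * sin phi)) => x.
rewrite waveE cosD; case: m => [|m] in mn *.
  rewrite eqxx mul0r cos0 sin0 !mul1r mul0r subr0 big_nat big1 ?addr0// => k.
  by case: k => // k _; rewrite !mul0r oppr0 mul0r addr0.
rewrite mul0r add0r (big_rem m.+1) ?mem_index_iota//= eqxx !mul1r.
rewrite big_seq big1 ?addr0 => [|k]; first by ring.
rewrite mem_rem_uniq ?iota_uniq// inE => /andP[/negbTE -> _].
by rewrite !mul0r oppr0 mul0r addr0.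
Qed.

Lemma trig_poly_waves n f : trig_poly n f -> exists a b : nat -> R,
  f = a 0%N *: wave 0 0
      + \sum_(1 <= k < n.+1) (a k *: wave k 0 + b k *: wave k (- (pi / 2))).
Proof.
move=> [a [b fE]]; exists a, b; apply: circle_fun_eq => x.
rewrite fE circle_funD circle_funZ waveE mul0r addr0 cos0 mulr1 circle_fun_sum.
congr (_ + _); apply: eq_bigr => k _.
by rewrite circle_funD !circle_funZ !waveE addr0 cosBpihalf.
Qed.

End Waves.

(** * Sampling with positive kernels *)

Section PositiveKernels.
Variable R : realType.
Local Notation CT := (circle_fun R).
Implicit Types (a : nat -> R) (f g : CT) (phi x y : R).

Definition autocorr (r : nat) a (k : nat) : R :=
  \sum_(0 <= i < r - k) a i * a (i + k)%N.

Lemma autocorrE r a k :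
  \sum_(0 <= i < r) \sum_(0 <= j < r) a i * a j * (i + k == j)%N%:R
  = autocorr r a k.
Proof.
rewrite /autocorr [RHS](@big_nat_widen _ _ _ _ _ r) ?leq_subr//.
rewrite [RHS]big_mkcond/=.
apply: eq_bigr => i _; rewrite ltn_subRL [(k + i)%N]addnC.
rewrite (eq_bigr (fun j => if (j == i + k)%N then a i * a j else 0)).
  by rewrite -big_mkcond big_nat1_eq.
by move=> j _; rewrite eq_sym; case: eqP; rewrite ?mulr1 ?mulr0.
Qed.

(** The squared modulus of [sum_j a_j e^(i j (x - y))], expanded. With truncated subtraction
    [i - j + (j - i)] is [|i - j|], so every frequency is a natural number. *)
Definition pos_kernel (r : nat) a y : CT :=
  \sum_(0 <= i < r) \sum_(0 <= j < r)
    (a i * a j) *: wave (i - j + (j - i)) (- ((i - j + (j - i))%:R * y)).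

Lemma cos_distn (i j : nat) x :
  cos ((i - j + (j - i))%:R * x) = cos ((i%:R - j%:R) * x).
Proof.
have [ij|ji] := leqP i j.
  rewrite (eqP ij) add0n natrB// -cosN; congr cos; ring.
by rewrite (eqP (ltnW ji)) addn0 natrB// ltnW.
Qed.

Lemma pos_kernelE r a y x : pos_kernel r a y x =
  \sum_(0 <= i < r) \sum_(0 <= j < r)
    a i * a j * cos ((i%:R - j%:R) * (x - y)).
Proof.
rewrite circle_fun_sum; apply: eq_bigr => i _.
rewrite circle_fun_sum; apply: eq_bigr => j _.
by rewrite circle_funZ waveE -mulrBr cos_distn.
Qed.

Lemma pos_kernel_ge0 r a y x : 0 <= pos_kernel r a y x.
Proof.
suff -> : pos_kernel r a y x =
    (\sum_(0 <= i < r) a i * cos (i%:R * (x - y))) ^+ 2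
  + (\sum_(0 <= i < r) a i * sin (i%:R * (x - y))) ^+ 2.
  by rewrite addr_ge0 ?sqr_ge0.
rewrite pos_kernelE !expr2 !big_distrlr/= -big_split; apply: eq_bigr => i _.
rewrite -big_split; apply: eq_bigr => j _/=.
by rewrite mulrBl cosB; ring.
Qed.

Lemma trig_poly_pos_kernel r n a y : (r <= n.+1)%N ->
  trig_poly n (pos_kernel r a y).
Proof.
move=> rn; rewrite /pos_kernel big_nat; apply: trig_poly_sum => i /andP[_ ir].
rewrite big_nat; apply: trig_poly_sum => j /andP[_ jr].
by apply/trig_polyZ/trig_poly_wave; lia.
Qed.

Definition kernel_op (M r : nat) a f : CT :=
  M%:R^-1 *: \sum_(0 <= l < M) f (node R M l) *: pos_kernel r a (node R M l).

Lemma kernel_op_linear M r a : linear (kernel_op M r a).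
Proof.
move=> c f g; rewrite /kernel_op scalerA mulrC -scalerA -scalerDr.
congr (_ *: _).
rewrite scaler_sumr -big_split/=; apply: eq_bigr => l _.
by rewrite [X in X *: _](_ : _ = c * f (node R M l) + g (node R M l)) // scalerDl scalerA.
Qed.

(** The product of the wave with a kernel term splits into the node frequencies [j + k - i] and
    [i + k - j]. As [k + r <= M], neither aliases, so only [i = j + k] and [j = i + k] survive. *)
Lemma kernel_op_wave M r a k phi : (0 < M)%N -> (k + r <= M)%N ->
  kernel_op M r a (wave k phi) = autocorr r a k *: wave k phi.
Proof.
move=> M0 krM; apply: circle_fun_eq => x.
have MN0 : M%:R != 0 :> R by rewrite pnatr_eq0; lia.
rewrite !circle_funZ circle_fun_sum.
under eq_bigr => l _.
  rewrite circle_funZ pos_kernelE mulr_sumr.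
  under eq_bigr do rewrite mulr_sumr.
  over.
rewrite exchange_big_nat/=.
under eq_bigr do rewrite exchange_big_nat/=.
rewrite mulr_sumr -autocorrE.
pose F (i j : nat) := a i * a j * ((j + k == i)%:R + (i + k == j)%:R)
                      * (wave k phi x / 2).
rewrite (eq_big_nat _ _ (F2 := fun i => \sum_(0 <= j < r) F i j)); last first.
  move=> i /andP[_ ir]; rewrite mulr_sumr; apply: eq_big_nat => j /andP[_ jr].
  under eq_bigr => l _.
    rewrite mulrCA cos_mul_cos.
    rewrite (_ : _ + (i%:R - j%:R) * _ =
       ((j + k)%N%:R - i%:R) * node R M l + (phi + (i%:R - j%:R) * x));
      last by rewrite natrD; ring.
    rewrite (_ : _ - (i%:R - j%:R) * _ =
       ((i + k)%N%:R - j%:R) * node R M l + (phi - (i%:R - j%:R) * x));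
      last by rewrite natrD; ring.
    over.
  rewrite -mulr_sumr -mulr_suml big_split/= !sum_cos_node; try lia.
  rewrite /F waveE.
  have -> : (j + k == i)%N%:R * M%:R * cos (phi + (i%:R - j%:R) * x)
          = (j + k == i)%N%:R * M%:R * cos (k%:R * x + phi).
    by case: eqP => [<-|]; rewrite ?mul0r// natrD; congr (_ * cos _); ring.
  have -> : (i + k == j)%N%:R * M%:R * cos (phi - (i%:R - j%:R) * x)
          = (i + k == j)%N%:R * M%:R * cos (k%:R * x + phi).
    by case: eqP => [<-|]; rewrite ?mul0r// natrD; congr (_ * cos _); ring.
  by field.
rewrite /F; under eq_bigr do rewrite -mulr_suml.
rewrite -mulr_suml mulrA mulrAC; congr (_ * _).
under eq_bigr do under eq_bigr do rewrite mulrDr.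
under eq_bigr do rewrite big_split.
(* Swapping [i] and [j] shows that both halves equal the autocorrelation, which cancels the factor
   1/2. *)
rewrite big_split/= [X in X + _]exchange_big_nat/=.
rewrite (eq_bigr (fun i => \sum_(0 <= j < r) a i * a j * (i + k == j)%N%:R)).
  by rewrite -mulr2n -mulr_natr; field.
by move=> i _; apply: eq_bigr => j _; rewrite [a j * _]mulrC.
Qed.

Lemma autocorr0_ge0 r a : 0 <= autocorr r a 0.
Proof. by apply: sumr_ge0 => i _; rewrite addn0 -expr2 sqr_ge0. Qed.

(** By positivity the absolute values of the weights sum to the image of the constant [wave 0 0],
    which is [autocorr r a 0]. *)
Lemma kernel_op_norm M r a f : (0 < M)%N -> (r <= M)%N ->
  `|kernel_op M r a f| <= autocorr r a 0 * `|f|.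
Proof.
move=> M0 rM; apply: circle_norm_le => x.
rewrite circle_funZ circle_fun_sum.
have := kernel_op_wave a 0 M0 (etrans (congr1 (leq^~ M) (add0n r)) rM).
move=> /(congr1 (fun f : CT => f x)).
rewrite !circle_funZ waveE mul0r add0r cos0 mulr1 circle_fun_sum => <-.
rewrite normrM ger0_norm ?invr_ge0// -mulrA ler_wpM2l ?invr_ge0// mulr_suml.
rewrite (le_trans (ler_norm_sum _ _ _))//; apply: ler_sum => l _.
rewrite !circle_funZ waveE mul0r add0r cos0 mul1r normrM mulrC.
by rewrite ger0_norm ?pos_kernel_ge0// ler_wpM2l ?pos_kernel_ge0// ler_circle_norm.
Qed.

End PositiveKernels.

(** * Multiplier operators *)

Section Multipliers.
Variable R : realType.
Local Notation CT := (circle_fun R).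
Implicit Types (a m : nat -> R) (f g : CT) (phi x y C : R).

(** Only the frequencies up to [L] are prescribed. A bound [C] replaces the exact norm, so that
    bounds add up under linear combinations. *)
Definition multiplier_op (L N : nat) m C := exists A : CT -> CT,
  [/\ linear A, forall f, `|A f| <= C * `|f|, forall f, trig_poly N (A f)
    & forall k phi, (k <= L)%N -> A (wave k phi) = m k *: wave k phi].

Lemma multiplier_op_ext L N m m' C C' :
  (forall k, (k <= L)%N -> m k = m' k) -> C <= C' ->
  multiplier_op L N m C -> multiplier_op L N m' C'.
Proof.
move=> mm' CC' [A [Alin Abd AN Am]]; exists A; split=> // [f|k phi kL].
  by rewrite (le_trans (Abd f))// ler_wpM2r.
by rewrite Am// mm'.
Qed.

Lemma multiplier_opD L N m m' C C' :
  multiplier_op L N m C -> multiplier_op L N m' C' ->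
  multiplier_op L N (m \+ m') (C + C').
Proof.
move=> [A [Alin Abd AN Am]] [B [Blin Bbd BN Bm]].
exists (fun f => A f + B f); split.
- by move=> c f g; rewrite Alin Blin scalerDr addrACA.
- by move=> f; rewrite (le_trans (ler_normD _ _))// mulrDl lerD.
- by move=> f; exact: trig_polyD.
- by move=> k phi kL; rewrite Am// Bm// scalerDl.
Qed.

Lemma multiplier_opZ L N m C (c : R) :
  multiplier_op L N m C -> multiplier_op L N (fun k => c * m k) (`|c| * C).
Proof.
move=> [A [Alin Abd AN Am]]; exists (fun f => c *: A f); split.
- by move=> d f g; rewrite Alin scalerDr !scalerA mulrC.
- by move=> f; rewrite normrZ -mulrA ler_wpM2l.
- by move=> f; exact: trig_polyZ.
- by move=> k phi kL; rewrite Am// scalerA.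
Qed.

Lemma multiplier_op_sum L N (n : nat) (m : nat -> nat -> R) (C : nat -> R) :
  (forall i, (i < n)%N -> multiplier_op L N (m i) (C i)) ->
  multiplier_op L N (fun k => \sum_(0 <= i < n) m i k) (\sum_(0 <= i < n) C i).
Proof.
elim: n => [|n IH] mC.
  exists (fun=> 0); split.
  - by move=> c f g; rewrite scaler0 addr0.
  - by move=> f; rewrite normr0 big_geq// mul0r.
  - by move=> f; have := trig_polyZ 0 (@trig_poly_wave R N 0 0 isT); rewrite scale0r.
  - by move=> k phi _; rewrite big_geq// scale0r.
have := multiplier_opD (IH (fun i ni => mC i (ltnW ni))) (mC n (leqnn _)).
apply: multiplier_op_ext => [k _|]; last by rewrite big_nat_recr.
by rewrite big_nat_recr.
Qed.

Lemma multiplier_op_autocorr L N r a : (r <= N.+1)%N ->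
  multiplier_op L N (autocorr r a) (autocorr r a 0).
Proof.
move=> rN; exists (kernel_op (L + N.+1) r a); split.
- exact: kernel_op_linear.
- by move=> f; apply: kernel_op_norm; lia.
- move=> f; apply/trig_polyZ/trig_poly_sum => l _.
  exact/trig_polyZ/trig_poly_pos_kernel.
- by move=> k phi kL; apply: kernel_op_wave; lia.
Qed.

(** The Fejer kernel: unit weights have the tent as autocorrelation. *)
Lemma multiplier_op_tent L N r : (r <= N.+1)%N ->
  multiplier_op L N (fun k => (r - k)%:R) r%:R.
Proof.
have E k : autocorr r (fun=> 1 : R) k = (r - k)%:R.
  by rewrite /autocorr; under eq_bigr do rewrite mul1r;
     rewrite sumr_const_nat subn0.
move=> /(multiplier_op_autocorr L (fun=> 1 : R)).
by apply: multiplier_op_ext => [k _|]; rewrite E// subn0.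
Qed.

(* The subtraction [i.+1 - k] is truncated: it is the tent (i + 1 - k)_+. *)
Lemma sum_second_difference (E : nat -> R) (k m : nat) : (k <= m.+1)%N ->
  \sum_(0 <= i < m) (E i.+2 - 2 * E i.+1 + E i) * (i.+1 - k)%:R
  = E k - E m.+1 + (m.+1 - k)%:R * (E m.+1 - E m).
Proof.
elim: m => [|m IH] km.
  by rewrite big_geq//; case: k km => [|[|//]] _; rewrite ?subn0 ?subnn; ring.
rewrite big_nat_recr//=; move: km; rewrite leq_eqVlt => /predU1P[->|km].
  rewrite subnn mul0r subrr addr0 (eqP (leqnSn m.+1)) mulr0 addr0.
  rewrite big_nat big1// => i /andP[_ im].
  by rewrite (_ : (i.+1 - m.+2)%N = 0%N) ?mulr0//; apply/eqP;
    rewrite subn_eq0; lia.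
rewrite IH; last exact: km.
by rewrite [(m.+2 - k)%N]subSn// -[(m.+1 - k).+1%:R]natr1; ring.
Qed.

(* By [sum_second_difference] the tents of height [r] at [r < L], weighted by the
   second differences of [E], give [E] up to an affine function on [0, L], which
   the tents ending at [L] and [2 * L] provide. *)
Lemma multiplier_op_quadratic L N (E : nat -> R) (B : R) :
  (0 < L)%N -> (2 * L <= N.+1)%N -> E 0 = 0 -> `|E 1| <= B ->
  (forall i, (i.+2 <= L)%N -> `|E i.+2 - 2 * E i.+1 + E i| <= B) ->
  multiplier_op L N E (5 * L%:R ^+ 2 * B).
Proof.
move=> L0 LN E0 E1 E2.
have B0 : 0 <= B by rewrite (le_trans _ E1).
(* The first difference is at most [B] because [E 0 = 0]; each second difference adds at most
   another [B]. *)
have dE i : (i < L)%N -> `|E i.+1 - E i| <= i.+1%:R * B.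
  elim: i => [_|i IH iL]; first by rewrite E0 subr0 mul1r.
  rewrite (_ : _ - _ = (E i.+2 - 2 * E i.+1 + E i) + (E i.+1 - E i)); last by ring.
  rewrite (le_trans (ler_normD _ _))// -[i.+2%:R]nat1r [leRHS]mulrDl mul1r.
  by rewrite lerD ?E2 ?IH// ltnW.
have LE i : (i <= L)%N -> `|E i| <= i%:R ^+ 2 * B.
  elim: i => [_|i IH iL]; first by rewrite E0 normr0 mulr_ge0 ?sqr_ge0.
  rewrite -[E i.+1](subrK (E i)) (le_trans (ler_normD _ _))//.
  rewrite (le_trans (lerD (dE i iL) (IH (ltnW iL))))// -mulrDl ler_wpM2r//.
  rewrite -natrX -natrD -natrX ler_nat; nia.
case: L L0 LN E2 dE LE => // L _ LN E2 dE LE.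
have LN0 : L.+1%:R != 0 :> R by rewrite pnatr_eq0.
have iN i : (i <= L)%N -> (i.+1 <= N.+1)%N by lia.
have P1 := @multiplier_op_sum L.+1 N L _ _ (fun i iL =>
  multiplier_opZ (E i.+2 - 2 * E i.+1 + E i)
    (multiplier_op_tent L.+1 (iN i (ltnW iL)))).
(* The first part of this coefficient cancels the linear term left by [P1]. The second part,
   together with [P3], produces the missing constant [E L.+1]. *)
have P2 := multiplier_opZ (- (E L.+1 - E L) - E L.+1 / L.+1%:R)
  (multiplier_op_tent L.+1 (iN L (leqnn _))).
have P3 := multiplier_opZ (E L.+1 / L.+1%:R) (multiplier_op_tent L.+1 LN).
have := multiplier_opD P1 (multiplier_opD P2 P3).
apply: multiplier_op_ext => [k kL|/=].
  rewrite /= sum_second_difference; last by lia.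
  rewrite !natrB; [|lia|lia].
  by rewrite natrM; field.
set e := E L.+1; set d := e - E L.
have He : `|e| <= L.+1%:R ^+ 2 * B by exact: LE.
have Hd : `|d| <= L.+1%:R * B by exact: dE.
have eL : `|e / L.+1%:R| * L.+1%:R = `|e|.
  by rewrite normrM [`|_^-1|]gtr0_norm ?invr_gt0 ?ltr0n// divfK.
rewrite natrM (mulrCA _ 2) eL.
have H2 : `|- d - e / L.+1%:R| * L.+1%:R <= 2 * L.+1%:R ^+ 2 * B.
  rewrite (le_trans (ler_wpM2r _ (ler_normB _ _)))// mulrDl eL normrN.
  have := ler_wpM2r (ler0n R L.+1) Hd; nra.
have H1 : \sum_(0 <= i < L) `|E i.+2 - 2 * E i.+1 + E i| * i.+1%:R
   <= L.+1%:R ^+ 2 * B.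
  apply: (@le_trans _ _ (\sum_(0 <= i < L) B * L.+1%:R)).
    rewrite !big_nat; apply: ler_sum => i /andP[_ iL].
    by rewrite ler_pM ?E2// ler_nat ltnW.
  rewrite sumr_const_nat subn0 -[_ *+ L]mulr_natl expr2 -mulrA [B * _]mulrC.
  by rewrite ler_wpM2r ?mulr_ge0// ler_nat.
(* The factor 5 is 1 + 2 + 2, from [P1], [P2] and [P3]. *)
lra.
Qed.

End Multipliers.

(** * The Fejer-Korovkin kernel *)

Section SineWeights.
Variables (R : realType) (n : nat).
Hypothesis n2 : (2 <= n)%N.

Let theta : R := pi / n%:R.
Let a (i : nat) : R := sin (i%:R * theta).

Let n0 : 0 < n%:R :> R. Proof. by rewrite ltr0n; lia. Qed.

Let theta0 : 0 <= theta.
Proof. by rewrite divr_ge0 ?pi_ge0// ltW. Qed.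

Let n_theta : n%:R * theta = pi.
Proof. by rewrite mulrC divfK// lt0r_neq0. Qed.

(** The weights are an eigenvector of the path with zero boundary values [a 0 = a n = 0]; all
    properties of the autocorrelation below come from this. *)
Let a_rec i : a i.+2 = 2 * cos theta * a i.+1 - a i.
Proof.
rewrite /a (_ : i.+2%:R * theta = i.+1%:R * theta + theta); last first.
  by rewrite -[i.+2%:R]natr1; ring.
rewrite (_ : i%:R * theta = i.+1%:R * theta - theta) ?sinD ?sinN ?cosN; first by ring.
by rewrite -[i.+1%:R]natr1; ring.
Qed.

Let a_le1 i : `|a i| <= 1. Proof. exact: sin_max. Qed.

Let an : a n = 0. Proof. by rewrite /a n_theta sinpi. Qed.

Let a0 : a 0 = 0. Proof. by rewrite /a mul0r sin0. Qed.

Let autocorr_a0 : autocorr n a 0 = n%:R / 2.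
Proof.
rewrite /autocorr subn0.
have c0 := @sum_cos_node_gt0 R n 1 0 _.
under eq_bigr => i _.
  rewrite addn0 (_ : a i * a i = 2^-1 - cos (1 * node R n i + 0) / 2); last first.
    have -> : 1 * node R n i + 0 = (i%:R * theta) *+ 2.
      by rewrite addr0 mul1r /node /theta !mulr2n; ring.
    by rewrite cos_mulr2n cos2sin2 /a mulr2n; field.
  over.
rewrite sumrB sumr_const_nat subn0 -mulr_suml c0 ?mul0r ?subr0//.
by rewrite mulr_natl.
Qed.

(** The zero boundary values let the sum be written with either neighbour of [i]; adding the two
    forms and applying [a_rec] gives twice the claim. *)
Let autocorr_a1 : autocorr n a 1 = cos theta * autocorr n a 0.
Proof.
have E : autocorr n a 1 = \sum_(0 <= i < n) a i * a i.+1.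
  rewrite /autocorr; case: n n2 an => // m _ am.
  rewrite subn1 big_nat_recr//= am mulr0 addr0.
  by apply: eq_bigr => i _; rewrite addn1.
have E' : autocorr n a 1 = \sum_(0 <= i < n) a i * a i.-1.
  rewrite /autocorr; case: n n2 => // m _.
  rewrite subn1 big_nat_recl//= a0 mul0r add0r.
  by apply: eq_bigr => i _; rewrite addn1 mulrC.
have : autocorr n a 1 + autocorr n a 1 = 2 * cos theta * autocorr n a 0.
  rewrite {1}E E' -big_split/= /autocorr subn0 mulr_sumr.
  apply: eq_bigr => -[|i] _; first by rewrite a0; ring.
  by rewrite addn0 a_rec; ring.
lra.
Qed.

(** Over the common range [i < n - k.+1] the terms cancel by [a_rec]. Lag [k.+2] is extended by a
    zero term, and lag [k] leaves one boundary term, with [a n.-1 = sin theta]. *)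
Let autocorr_a_rec k : (k.+2 <= n)%N ->
  autocorr n a k.+2 - 2 * cos theta * autocorr n a k.+1 + autocorr n a k
  = a (n - k.+1) * sin theta.
Proof.
move=> kn.
have -> : autocorr n a k.+2 = \sum_(0 <= i < n - k.+1) a i * a (i + k.+2)%N.
  rewrite (_ : n - k.+1 = (n - k.+2).+1)%N; last lia.
  rewrite big_nat_recr//= (_ : (n - k.+2 + k.+2)%N = n); last lia.
  by rewrite an mulr0 addr0.
have -> : autocorr n a k =
    \sum_(0 <= i < n - k.+1) a i * a (i + k)%N + a (n - k.+1)%N * sin theta.
  rewrite /autocorr (_ : n - k = (n - k.+1).+1)%N; last lia.
  rewrite big_nat_recr//= (_ : (n - k.+1 + k)%N = n.-1); last lia.
  congr (_ + _ * _); rewrite /a (_ : n.-1%:R * theta = pi - theta); last first.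
    by rewrite -subn1 natrB ?mulrBl ?n_theta ?mul1r//; lia.
  by rewrite sinB sinpi cospi; ring.
rewrite /autocorr mulr_sumr -sumrB addrA -big_split/= big1 ?add0r// => i _.
by rewrite !addnS a_rec; ring.
Qed.

Let autocorr_a_le k : `|autocorr n a k| <= n%:R.
Proof.
rewrite /autocorr (le_trans (ler_norm_sum _ _ _))//.
apply: (@le_trans _ _ (\sum_(0 <= i < n - k) 1)).
  by apply: ler_sum => i _; rewrite normrM mulr_ile1.
by rewrite sumr_const_nat subn0 ler_nat leq_subr.
Qed.

Let theta_le : 1 - cos theta <= theta ^+ 2 / 2.
Proof.
apply: one_sub_cos_le => //.
by rewrite ler_pdivrMr// ler_peMr ?pi_ge0// ler1n; lia.
Qed.

Lemma multiplier_op_one L N : (0 < L)%N -> (2 * L <= n)%N -> (n <= N.+1)%N ->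
  multiplier_op L N (fun=> 1 : R)
    (1 + 5 * L%:R ^+ 2 * ((2 * pi ^+ 2 + 2 * pi) / n%:R ^+ 2)).
Proof.
move=> L0 Ln nN.
pose rho k := autocorr n a k / autocorr n a 0.
have rho0 : rho 0 = 1 by rewrite /rho autocorr_a0 divff// lt0r_neq0// divr_gt0.
pose E k := 1 - rho k.
set B := _ / n%:R ^+ 2.
have BE : B = 2 * theta ^+ 2 + 2 * (theta / n%:R).
  by rewrite /B /theta; field; rewrite lt0r_neq0.
have tn0 : 0 <= theta / n%:R by rewrite divr_ge0// ltW.
have E1 : `|E 1| <= B.
  have -> : E 1 = 1 - cos theta.
    by rewrite /E /rho autocorr_a1 mulfK// autocorr_a0 lt0r_neq0// divr_gt0.
  have := sqr_ge0 theta; have := theta_le; have := cos_le1 theta.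
  by rewrite BE => *; rewrite ger0_norm; lra.
have E2 i : (i.+2 <= L)%N -> `|E i.+2 - 2 * E i.+1 + E i| <= B.
  move=> iL; have ni : (i.+2 <= n)%N by lia.
  have H := autocorr_a_rec ni; set s := a _ in H.
  (* Replacing [2 * cos theta] by 2 in [autocorr_a_rec] costs the first term, at most
     [2 * theta ^+ 2]; the boundary term gives the second, at most [2 * (theta / n)]. *)
  have -> : E i.+2 - 2 * E i.+1 + E i =
      2 * (1 - cos theta) * (rho i.+1) - 2 * (s * sin theta) / n%:R.
    rewrite -H /E /rho autocorr_a0; field; exact: lt0r_neq0.
  rewrite BE (le_trans (ler_normB _ _))// lerD//.
    have r2 : `|rho i.+1| <= 2.
      rewrite /rho autocorr_a0 normrM [`|_^-1|]ger0_norm ?invr_ge0 ?divr_ge0//.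
      by rewrite ler_pdivrMr ?divr_gt0// mulrCA divff// mulr1 autocorr_a_le.
    rewrite normrM [`|2 * _|]ger0_norm; last first.
      by rewrite mulr_ge0// subr_ge0 cos_le1.
    have c0 : 0 <= 1 - cos theta by rewrite subr_ge0 cos_le1.
    have := ler_wpM2l c0 r2; have := theta_le; lra.
  rewrite -mulrA normrM ger0_norm// ler_pM2l// normrM.
  rewrite [`|_^-1|]ger0_norm ?invr_ge0 ?(ltW n0)// ler_wpM2r ?invr_ge0 ?(ltW n0)//.
  rewrite normrM -[leRHS]mul1r ler_pM//; first exact: a_le1.
  rewrite ger0_norm ?sin_le_id// sin_ge0_pi// theta0/=.
  by rewrite ler_pdivrMr// ler_peMr ?pi_ge0// ler1n; lia.
(* The normalised kernel contributes norm at most 1, so only the correction of its defect [E]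
   exceeds 1. *)
have Erho := multiplier_opD
  (multiplier_opZ (autocorr n a 0)^-1 (multiplier_op_autocorr L a nN))
  (multiplier_op_quadratic L0 (leq_trans Ln nN) (_ : E 0 = 0) E1 E2).
apply: multiplier_op_ext (Erho _); last by rewrite /E rho0 subrr.
  by move=> k _ /=; rewrite /E /rho; ring.
rewrite lerD2r ger0_norm ?invr_ge0 ?autocorr0_ge0// mulVf//.
by rewrite autocorr_a0 lt0r_neq0// divr_gt0.
Qed.

End SineWeights.

(** * Norm estimates *)

Section Bounds.
Variable R : realType.
Local Notation CT := (circle_fun R).

Lemma ler_op_norm (A : {linear CT -> CT}) (f : CT) :
  bounded_near A (nbhs (0 : CT)) -> `|f| <= 1 -> `|A f| <= op_norm A.
Proof.
move=> /op_norm_has_sup [_ ubA] f1.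
by apply: ub_le_sup => //; exists f.
Qed.

Lemma op_norm_le (A : CT -> CT) (C : R) :
  (forall f : CT, `|f| <= 1 -> `|A f| <= C) -> op_norm A <= C.
Proof.
move=> Abd; apply: ge_sup; last by move=> _ [f /= f1 <-]; exact: Abd.
by exists `|A 0|, 0 => //=; rewrite normr0.
Qed.

Lemma multiplier_op_reproducing (L N : nat) (C : R) :
  multiplier_op L N (fun=> 1) C ->
  exists2 A : {linear CT -> CT}, reproducing_op L N A & op_norm A <= C.
Proof.
move=> [A [Alin Abd AN A1]].
pose Amixin := GRing.isLinear.Build R CT CT *:%R A Alin.
have [A' AE] : exists A' : {linear CT -> CT}, A' =1 A.
  by exists (HB.pack_for {linear CT -> CT} A Amixin).
(* [A] fixes a nonzero wave, so its bound cannot be negative. *)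
have C0 : 0 <= C.
  have := Abd (wave 0 (0 : R)); rewrite A1// scale1r.
  have w0 : 0 < `|wave 0 (0 : R)|.
    rewrite (lt_le_trans ltr01)// (le_trans _ (ler_circle_norm _ 0))//.
    by rewrite waveE mul0r addr0 cos0 normr1.
  by move=> /(le_trans (normr_ge0 _)); rewrite pmulr_lge0.
exists A'; last first.
  by apply: op_norm_le => f f1; rewrite AE (le_trans (Abd f))// ler_piMr.
split=> [|p /trig_poly_waves [a [b ->]]|_ [f _ <-]]; last by rewrite AE.
  apply/bounded_funP => r; exists (C * r) => f fr.
  by rewrite AE (le_trans (Abd f))// ler_wpM2l.
rewrite linearD linearZ linear_sum/= AE A1// scale1r; congr (_ + _).
rewrite big_nat [RHS]big_nat; apply: eq_bigr => k /andP[_ kL].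
by rewrite linearD !linearZ/= !AE !A1 ?scale1r.
Qed.

(** The correction lies between 0 and [1 - cos x], the upper bound being [one_sub_cos_mulnl]. *)
Lemma normr_test_fun (s : nat) (x : R) : (0 < s)%N ->
  `|cos x + s%:R ^- 2 * (1 - cos (s%:R * x))| <= 1.
Proof.
move=> s0; have s2 : 0 < s%:R ^+ 2 :> R by rewrite exprn_gt0 ?ltr0n.
have := one_sub_cos_mulnl s x; rewrite -ler_pdivrMl//.
have : 0 <= s%:R ^- 2 * (1 - cos (s%:R * x)).
  by rewrite mulr_ge0 ?invr_ge0 ?(ltW s2)// subr_ge0 cos_le1.
by have := cos_geN1 x; rewrite ler_norml => *; apply/andP; split; lra.
Qed.

(* [(-1) ^+ j] is [cos (n * y_j)] at the nodes [y_j = pi * j / n]. *)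
Lemma alternating_sum_trig_poly (n N : nat) (q : CT) : (N < n)%N ->
  trig_poly N q -> \sum_(0 <= j < 2 * n) (-1) ^+ j * q (- node R (2 * n) j) = 0.
Proof.
move=> Nn /trig_poly_waves [a [b ->]].
have alt k phi : (k <= N)%N ->
    \sum_(0 <= j < 2 * n) (-1) ^+ j * wave k phi (- node R (2 * n) j) = 0.
  move=> kN.
  under eq_bigr => j _.
    rewrite waveE -(alternatingn (@cosDpi R)).
    (* The sign is absorbed as a shift by [pi * j = n * y_j], leaving the frequency [n - k], which
       lies strictly between 0 and [2 * n]. *)
    rewrite (_ : _ + pi *+ j = (n%:R - k%:R) * node R (2 * n) j + phi); last first.
      rewrite mulrBl (_ : n%:R * node R (2 * n) j = pi *+ j); first by ring.
      rewrite /node natrM -[RHS]mulr_natl mulr2n; field.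
      by rewrite pnatr_eq0; lia.
    over.
  rewrite sum_cos_node; try lia.
  by rewrite (_ : (n == k) = false) ?mul0r//; apply/eqP; lia.
under eq_bigr do
  rewrite circle_funD circle_funZ circle_fun_sum mulrDr mulr_sumr mulrCA.
rewrite big_split -[LHS]/(_ + _) -mulr_sumr alt// mulr0 add0r exchange_big_nat.
rewrite big_nat; apply: big1 => k /andP[_ kN].
under eq_bigr do rewrite circle_funD !circle_funZ mulrDr !(mulrCA (_ ^+ _)).
by rewrite big_split -[LHS]/(_ + _) -!mulr_sumr !alt// !mulr0 addr0.
Qed.

Lemma op_norm_ge (s L : nat) (A : {linear CT -> CT}) :
  (0 < s)%N -> (0 < L)%N -> reproducing_op L (s * L - 1) A ->
  1 + s%:R ^- 2 <= op_norm A.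
Proof.
move=> s0 L0 [Ab Ap Ar]; set n := (s * L)%N.
have n0 : (0 < n)%N by rewrite muln_gt0 s0.
set y := node R (2 * n); set q := A (wave n 0).
have Aq : trig_poly (n - 1) q by apply: Ar; exists (wave n 0).
(* The test function translated by [y j]: since [n * y j = pi * j], translating [wave n 0] only
   changes its sign. Evaluating [A (f j)] at [- y j] undoes the translation. *)
pose f j := wave L (L%:R * y j)
            + s%:R ^- 2 *: (wave 0 0 - (-1) ^+ j *: wave n 0).
have f1 j : `|f j| <= 1.
  apply: circle_norm_le => x.
  rewrite circle_funD circle_funZ circle_funD.
  rewrite [(- _ : CT) x](_ : _ = - ((-1) ^+ j * wave n 0 x))//.
  rewrite !waveE mul0r !addr0 cos0 -(alternatingn (@cosDpi R)) -mulrDr.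
  rewrite (_ : _ + pi *+ j = s%:R * (L%:R * (x + y j))) ?normr_test_fun//.
  rewrite mulrA -natrM -/n mulrDr; congr (_ + _).
  rewrite /y /node natrM -[LHS]mulr_natl mulr2n; field.
  by rewrite pnatr_eq0; lia.
have AfE j : A (f j) (- y j) = 1 + s%:R ^- 2 - s%:R ^- 2 * ((-1) ^+ j * q (- y j)).
  rewrite /f linearD linearZZ linearB linearZZ -/q !Ap; try exact: trig_poly_wave.
  rewrite circle_funD circle_funZ circle_funD.
  rewrite [(- _ : CT) _](_ : _ = - ((-1) ^+ j * q (- y j)))//.
  rewrite !waveE mul0r !addr0 mulrN addNr cos0; ring.
have Af j : A (f j) (- y j) <= op_norm A.
  by rewrite (le_trans (ler_norm _))// (le_trans (ler_circle_norm _ _))// ler_op_norm.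
have : \sum_(0 <= j < 2 * n) A (f j) (- y j) <= \sum_(0 <= j < 2 * n) op_norm A.
  by apply: ler_sum => j _; exact: Af.
(* Summing over [j] removes the unknown image [q], whose degree is below [n]. *)
under eq_bigr do rewrite AfE.
rewrite sumrB -mulr_sumr (alternating_sum_trig_poly _ Aq); last by lia.
by rewrite mulr0 subr0 !sumr_const_nat subn0 lerMn2r; case/orP => //; lia.
Qed.

End Bounds.

Theorem corollary5p1 (R : realType) :
  exists c C : R, [/\ 0 < c, c <= C &
    forall s L : nat, (3 <= s)%N -> (1 <= L)%N ->
      c * s%:R ^- 2 <= lambda1 R L (s * L - 1)%N - 1 <= C * s%:R ^- 2].
Proof.
(* The second constant is that of [multiplier_op_one] at [n = s * L], where [L ^+ 2 / n ^+ 2] is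
   [s ^- 2]. *)
exists 1, (5 * (2 * pi ^+ 2 + 2 * pi)); split=> //.
  have := @pi_ge2 R; have := sqr_ge0 (@pi R); lra.
move=> s L s3 L1.
have lb A : reproducing_op L (s * L - 1) A -> 1 + s%:R ^- 2 <= @op_norm R A.
  by apply: op_norm_ge => //; lia.
have [A HA Abd] : exists2 A, reproducing_op L (s * L - 1) A &
    @op_norm R A <= 1 + 5 * L%:R ^+ 2 * ((2 * pi ^+ 2 + 2 * pi) / (s * L)%:R ^+ 2).
  by apply/multiplier_op_reproducing/multiplier_op_one; nia.
have lbS : lbound [set op_norm A | A in @reproducing_op R L (s * L - 1)]%classic
    (1 + s%:R ^- 2) by move=> _ [B HB <-]; exact: lb.
rewrite mul1r lerBrDl lerBlDl; apply/andP; split.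
  (* The operator [A] from the upper bound also shows that the infimum is over a nonempty set. *)
  by apply: lb_le_inf lbS; exists (op_norm A), A.
apply: (@le_trans _ _ (op_norm A)).
  by apply: ge_inf; [exists (1 + s%:R ^- 2)|exists A].
rewrite (le_trans Abd)// lerD2l le_eqVlt; apply/orP; left; apply/eqP.
by rewrite natrM; field; rewrite !pnatr_eq0; lia.
Qed.
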